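(* Let $G$ be a finite $2$-edge-coloured graph and let $k \geq 1$ be an integer. Then $G \to D_k$ if and only if for all $F \in \mathcal{F}_k$, $F \not\to G$.
   Context: A $2$-edge-coloured graph $G$ is a vertex set $V(G)$ together with two sets $E_1(G), E_2(G)$ of undirected edges; colour 1 is called blue and colour 2 is called red. Loops are allowed, and parallel edges (and parallel loops) are allowed provided they have different colours. A homomorphism $\varphi : G \to H$ of $2$-edge-coloured graphs is a map $\varphi : V(G) \to V(H)$ such that $uv \in E_i(G)$ implies $\varphi(u)\varphi(v) \in E_i(H)$ for $i = 1,2$. We write $G \to H$ if a homomorphism exists and $G \not\to H$ otherwise. Alternating paths. For $k \geq 1$, $F^B_k$ and $F^R_k$ are paths of length $k$ (that is, with $k$ edges) on distinct vertices $v_0, v_1, \dots, v_k$ with edges $v_{t}v_{t+1}$, whose edges successively alternate in colour between blue and red. When $k$ is odd, the middle edge $v_{\lfloor k/2\rfloor}v_{\lceil k/2\rceil}$ is blue in $F^B_k$ and red in $F^R_k$. When $k$ is even, the two alternating paths of length $k$ are isomorphic, and $F_k = F_k^B = F_k^R$ denotes either. Set $\mathcal{F}_k := \{F^R_k, F^B_k\}$ (so $\mathcal{F}_k = \{F_k\}$ when $k$ is even). Targets. For $k \geq 1$ let $j = \lfloor k/2 \rfloor$. The $2$-edge-coloured graph $D_k$ has vertex set $\{\pm 1, \pm 2, \dots, \pm j\}$ if $k$ is even and $\{0, \pm 1, \pm 2, \dots, \pm j\}$ if $k$ is odd. There are blue loops on $1, 2, \dots, j$, red loops on $-1, -2, \dots,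 -j$, and exactly one edge $rs$ for each pair of vertices with $|r| < |s|$; this edge is blue if $r > 0$ and red if $r < 0$, and if $r = 0$ it is blue if $s > 0$ and red if $s < 0$. There are no other edges or loops. *)

(* Defs.v *)
From HB Require Import structures.
From mathcomp Require Import all_boot all_order all_algebra.

Set Implicit Arguments.
Unset Strict Implicit.
Unset Printing Implicit Defensive.

Import Order.TTheory GRing.Theory Num.Theory.

Variant colour := Blue | Red.

Definition bool_of_colour (c : colour) : bool := if c is Blue then true else false.
Definition colour_of_bool (b : bool) : colour := if b then Blue else Red.
Lemma bool_of_colourK : cancel bool_of_colour colour_of_bool.
Proof. by case. Qed.
HB.instance Definition _ := Equality.copy colour (can_type bool_of_colourK).

Definition other (c : colour) : colour := if c is Blue then Red else Blue.

(* [edge G c u v] says that uv is an edge of colour [c]; u = v is a loop.  Each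
   colour has its own relation, so parallel edges of different colours are
   possible and parallel edges of the same colour are not. *)
Record ecgraph (V : Type) := ECGraph {
  edge : colour -> rel V;
  edge_sym : forall c, symmetric (edge c)
}.

Definition is_echom (V W : Type) (G : ecgraph V) (H : ecgraph W) (phi : V -> W) : Prop :=
  forall (c : colour) (u v : V), edge G c u v -> edge H c (phi u) (phi v).

Definition echom (V W : Type) (G : ecgraph V) (H : ecgraph W) : Prop :=
  exists phi : V -> W, is_echom G H phi.

(* Colour of the edge v_t v_(t+1) of the alternating path of length k whose edge
   number k./2 (the middle one when k is odd) has colour c. *)
Definition alt_colour (c : colour) (k t : nat) : colour :=
  if odd t == odd k./2 then c else other c.

Definition alt_path_edge (c : colour) (k : nat) (d : colour) : rel 'I_k.+1 :=
  fun u v =>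
    ((v == u.+1 :> nat) && (alt_colour c k u == d))
    || ((u == v.+1 :> nat) && (alt_colour c k v == d)).

Lemma alt_path_edge_sym (c : colour) (k : nat) (d : colour) :
  symmetric (alt_path_edge c (k := k) d).
Proof. by move=> u v; rewrite /alt_path_edge orbC. Qed.

(* F^B_k for c = Blue and F^R_k for c = Red.  For k even these are the two
   labellings of the alternating path of length k, exchanged by reversal. *)
Definition alt_path (c : colour) (k : nat) : ecgraph 'I_k.+1 :=
  ECGraph (@alt_path_edge_sym c k).

Definition alt_family (k : nat) (F : ecgraph 'I_k.+1) : Prop :=
  F = alt_path Red k \/ F = alt_path Blue k.

Definition D_vertex (k : nat) : Type :=
  {x : int | (`|x| <= k./2)%N && (odd k || (x != 0%R))}.

Definition has_sign (c : colour) (x : int) : bool :=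
  if c is Blue then (0 < x)%R else (x < 0)%R.

(* Colour c edge rs with |r| < |s|: the colour is the sign of r, or that of s
   when r = 0. *)
Definition D_link (c : colour) (r s : int) : bool :=
  (`|r| < `|s|)%N && (if r == 0%R then has_sign c s else has_sign c r).

Definition D_edge (k : nat) (c : colour) : rel (D_vertex k) :=
  fun u v =>
    [|| (val u == val v) && has_sign c (val u),
        D_link c (val u) (val v) | D_link c (val v) (val u)].

Lemma D_edge_sym (k : nat) (c : colour) : symmetric (@D_edge k c).
Proof.
move=> u v; rewrite /D_edge [val v == val u]eq_sym.
by case: eqP => [-> //|_] /=; rewrite orbC.
Qed.

Definition Dtarget (k : nat) : ecgraph (D_vertex k) := ECGraph (@D_edge_sym k).

(* Main.v *)
(** Let b(v) and r(v) be the maximal lengths of alternating walks from v whose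
    first edge is blue, respectively red.  A blue walk and a red walk from v
    concatenate, so if G has no alternating walk of length k then
    b(v) + r(v) < k.  A blue edge uv gives r(u) < b(v) and r(v) < b(u), hence
    its endpoint with the smaller min(b, r) has r < b.  So mapping v to
    r(v) + 1 if r(v) < b(v), to -(b(v) + 1) if b(v) < r(v), and ties to 0
    (k odd) or to r(v) + 1 (k even) is a homomorphism to D_k.  Conversely, in
    D_k alternating walks have length less than k, because a walk whose first
    edge has the colour of the sign of x has length at most k - |x|, and one
    starting with the other colour has length at most |x| - 1. *)
Require Import Defs.
From HB Require Import structures.
From mathcomp Require Import all_boot all_order all_algebra.
From mathcomp Require Import zify.

Set Implicit Arguments.
Unset Strict Implicit.
Unset Printing Implicit Defensive.

Lemma otherK : involutive other.
Proof. by case. Qed.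

Lemma alt_colourS (c : colour) (k t : nat) :
  alt_colour c k t.+1 = other (alt_colour c k t).
Proof. by rewrite /alt_colour /=; case: (odd t) (odd k./2) c => [] [] []. Qed.

Lemma alt_colour_start (c : colour) (k : nat) :
  exists d, alt_colour d k 0 = c.
Proof.
(* As a map of [c], this is the identity or [other], hence an involution. *)
exists (alt_colour c k 0).
by rewrite /alt_colour; case: (odd k./2) c => [] [].
Qed.

Section AlternatingWalks.

Variables (V : finType) (G : ecgraph V).

Fixpoint alt_walk (c : colour) (n : nat) (v : V) : bool :=
  if n is m.+1 then [exists w, edge G c v w && alt_walk (other c) m w] else true.

Lemma alt_walk_leq c m n v : m <= n -> alt_walk c n v -> alt_walk c m v.
Proof.
elim: n m c v => [|n IHn] [|m] c v //= le_mn /existsP[w /andP[vw walk_w]].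
by apply/existsP; exists w; rewrite vw (IHn m).
Qed.

(** Edges pass one by one from the first walk, reversed, to the front of the second, and the common
    start moves along. *)
Lemma alt_walk_join c m n v :
  alt_walk c m v -> alt_walk (other c) n v -> exists d u, alt_walk d (m + n) u.
Proof.
elim: m n c v => [|m IHm] n c v; first by move=> _ ?; exists (other c), v.
move=> /existsP[w /andP[vw walk_w]] walk_v.
rewrite addSnnS; apply: (IHm _ _ _ walk_w); rewrite otherK /=.
by apply/existsP; exists v; rewrite edge_sym vw.
Qed.

Lemma alt_walkP c n v :
  alt_walk c n v <-> exists2 p : nat -> V, p 0 = v &
    forall i, i < n -> edge G (if odd i then other c else c) (p i) (p i.+1).
Proof.
elim: n c v => [|n IHn] c v /=; first by split=> // _; exists (fun=> v).
split=> [/existsP[w /andP[vw /IHn[p p0 pE]]]|[p p0 pE]].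
  exists (fun i => if i is j.+1 then p j else v) => // -[|i] /=; first by rewrite p0.
  by move=> /pE; case: odd; rewrite /= ?otherK.
apply/existsP; exists (p 1); have /= := pE 0 isT; rewrite p0 => -> /=.
apply/IHn; exists (p \o succn) => // i /= lt_in.
by have := pE i.+1 lt_in => /=; case: odd; rewrite /= ?otherK.
Qed.

Lemma alt_path_homP c k :
  echom (alt_path c k) G <-> exists v, alt_walk (alt_colour c k 0) k v.
Proof.
have colE i : (if odd i then other (alt_colour c k 0) else alt_colour c k 0)
              = alt_colour c k i.
  by elim: i => //= i; rewrite alt_colourS => <-; case: odd; rewrite /= ?otherK.
split=> [[phi phiH]|[v /alt_walkP[p _ pE]]].
  exists (phi ord0); apply/alt_walkP.
  exists (phi \o inord) => [|i lt_ik /=]; first by congr phi; apply/val_inj; rewrite /= inordK.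
  rewrite colE; apply: phiH; rewrite /= /alt_path_edge !inordK ?ltnS //; last exact: ltnW.
  by rewrite !eqxx.
exists (p \o val) => d x y /= /orP[] /andP[/eqP e /eqP <-].
  by rewrite e -colE; apply: pE; rewrite -ltnS -e.
by rewrite e -colE edge_sym; apply: pE; rewrite -ltnS -e.
Qed.

(** [f c v] is the maximal length of an alternating walk from [v] with first colour [c]. *)
Lemma alt_depth k : (forall c v, ~~ alt_walk c k v) ->
  exists f : colour -> V -> nat,
    [/\ forall c v, f c v + f (other c) v < k
      & forall c u v, edge G c u v -> f (other c) v < f c u].
Proof.
move=> walkF.
have ex c v : exists n, alt_walk c n v by exists 0.
have ub c v n : alt_walk c n v -> n <= k.
  by move=> walk_n; case: leqP => // /ltnW/alt_walk_leq/(_ walk_n); rewrite (negPf (walkF c v)).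
pose f c v := ex_maxn (ex c v) (ub c v).
have fW c v : alt_walk c (f c v) v by rewrite /f; case: ex_maxnP.
have fM c v n : alt_walk c n v -> n <= f c v by rewrite /f; case: ex_maxnP => ? _; apply.
exists f; split=> [c v|c u v uv]; last first.
  by apply: fM => /=; apply/existsP; exists v; rewrite uv fW.
have [d [u walk_u]] := alt_walk_join (fW c v) (fW (other c) v).
by case: ltnP => // /alt_walk_leq/(_ walk_u); rewrite (negPf (walkF d u)).
Qed.

End AlternatingWalks.

(** Bounds alternating walks from [x] with first colour [c]; the signless vertex 0 gets [k./2] for
    both colours. *)
Definition D_height (k : nat) (c : colour) (x : int) : nat :=
  if x == 0%R then k./2 else if has_sign c x then k - `|x| else `|x|.-1.

Lemma D_height_edge k c (u v : D_vertex k) :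
  edge (Dtarget k) c u v -> D_height k (other c) (val v) < D_height k c (val u).
Proof.
case: u v => [x /= xk] [y /= yk]; rewrite /D_edge /D_link /D_height /=.
have := odd_double_half k.
by case: c => /=; do ?case: ifP => ? /=; lia.
Qed.

Lemma D_height_lt k c (u : D_vertex k) : 0 < k -> D_height k c (val u) < k.
Proof.
case: u => [x /= xk] k_gt0; rewrite /D_height.
by have := odd_double_half k; case: c => /=; case: eqP; try case: ifP; lia.
Qed.

(* For k odd, a tie b = r = k./2 would be sent to k./2 + 1, outside of D_k;
   hence the value 0. *)
Definition D_value (k b r : nat) : int :=
  if (b == r) && odd k then 0%R else
  if r <= b then (r.+1%:Z)%R else (- b.+1%:Z)%R.

(** Outside the tie sent to 0, parity and [b + r < k] give [minn b r < k./2]. *)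
Lemma D_value_subproof k b r : b + r < k ->
  (`|D_value k b r| <= k./2) && (odd k || (D_value k b r != 0%R)).
Proof.
rewrite /D_value; have := odd_double_half k.
by case: (odd k) => /=; case: (eqVneq b r) => ? /=; case: (leqP r b) => ? /=; lia.
Qed.

Theorem theorem2p5 (V : finType) (G : ecgraph V) (k : nat) (hk : 1 <= k) :
  echom G (Dtarget k) <-> (forall F : ecgraph 'I_k.+1, alt_family F -> ~ echom F G).
Proof.
split=> [[psi psiH] F famF homF|noF].
  have [c [v walk_v]] : exists c v, alt_walk G c k v.
    by case: famF homF => -> /alt_path_homP[v]; eexists; exists v; eassumption.
  (* Each step of the walk switches the colour and strictly lowers the height of the image. *)
  suff hW n d u : alt_walk G d n u -> n <= D_height k d (val (psi u)).
    by have := hW _ _ _ walk_v; rewrite leqNgt D_height_lt.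
  elim: n d u => //= n IHn d u /existsP[w /andP[/psiH uw /IHn]].
  by move=> /leq_ltn_trans; apply; apply: D_height_edge.
have walkF c v : ~~ alt_walk G c k v.
  apply/negP => walk_v; have [d dE] := alt_colour_start c k.
  have famF : alt_family (alt_path d k) by case: (d); [right|left].
  by apply: (noF _ famF); apply/alt_path_homP; exists v; rewrite dE.
have [f [f_lt f_edge]] := alt_depth walkF.
exists (fun v => Sub (D_value k (f Blue v) (f Red v)) (D_value_subproof (f_lt Blue v))).
move=> c u v uv.
have := f_edge _ _ _ uv; rewrite edge_sym in uv; have := f_edge _ _ _ uv.
rewrite /= /D_edge /D_link /D_value /=.
move: (f_lt Blue u) (f_lt Blue v) => /=; case: c {uv} => /=;
move: (f Blue u) (f Red u) (f Blue v) (f Red v) => bu ru bv rv;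
by case: (odd k) => /=; case: (eqVneq bu ru) => ? /=;
   case: (eqVneq bv rv) => ? /=; case: (leqP ru bu) => ? /=;
   case: (leqP rv bv) => ? /=; lia.
Qed.
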